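(* Every countable infinite group $G$ possesses a syndetic submeasure, i.e., there is a left-invariant submeasure $\mu:\mathcal P(G)\to[0,1]$ such that for each real $\varepsilon>\frac1{|G|}=0$ and each subset $A\subset G$ with $\mu(A)<1$ there is a set $B\subset G\setminus A$ such that $\mu(B)<\varepsilon$ and $FB=G$ for some finite subset $F\subset G$.
   Context: $\mathcal P(G)$ is the family of all subsets of $G$. A function $\mu:\mathcal P(G)\to[0,1]$ is a submeasure if it is monotone ($\mu(A)\le\mu(B)$ for $A\subset B\subset G$), subadditive ($\mu(A\cup B)\le\mu(A)+\mu(B)$ for all $A,B\subset G$), $\mu(\emptyset)=0$ and $\mu(G)=1$. It is left-invariant if $\mu(gA)=\mu(A)$ for all $g\in G$, $A\subset G$. For $F,B\subset G$, $FB=\{fb:f\in F,\ b\in B\}$. The convention is $\frac1{|G|}=0$ for infinite $G$. *)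

(* Defs.v *)
From mathcomp Require Import all_boot all_order all_algebra.
From mathcomp Require Import finmap.
From mathcomp Require Import all_classical all_reals.

Set Implicit Arguments.
Unset Strict Implicit.
Unset Printing Implicit Defensive.

Import Order.TTheory GRing.Theory Num.Theory.

Local Open Scope classical_set_scope.
Local Open Scope ring_scope.

(* Only finite subadditivity is required; the codomain [0, 1] is expressed by
   the first field. *)
Record is_submeasure (R : realType) (G : Type) (mu : set G -> R) : Prop :=
  IsSubmeasure {
    submeasure_itv : forall A : set G, 0 <= mu A <= 1 ;
    submeasure_mono : forall A B : set G, A `<=` B -> mu A <= mu B ;
    submeasure_subadd : forall A B : set G, mu (A `|` B) <= mu A + mu B ;
    submeasure0 : mu set0 = 0 ;
    submeasureT : mu setT = 1
  }.

Definition translate (G : groupType) (g : G) (A : set G) : set G :=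
  [set (g * a)%g | a in A].

Definition set_prod (G : groupType) (F B : set G) : set G :=
  [set (f * b)%g | f in F & b in B].

Definition left_invariant (R : realType) (G : groupType) (mu : set G -> R) :
    Prop :=
  forall (g : G) (A : set G), mu (translate g A) = mu A.

(* 1 / |G|.  For infinite G, [fset_set setT] is the empty fset, so the value is
   0^-1 = 0, which is the usual convention. *)
Definition inv_card (R : realType) (G : groupType) : R :=
  (#|` fset_set [set: G]|%fset)%:R^-1.

Record is_syndetic_submeasure (R : realType) (G : groupType)
    (mu : set G -> R) : Prop := IsSyndeticSubmeasure {
  syndetic_submeasure : is_submeasure mu ;
  syndetic_left_invariant : left_invariant mu ;
  syndetic_small : forall (eps : R) (A : set G),
    inv_card R G < eps -> mu A < 1 ->
    exists B : set G,
      [/\ B `<=` ~` A, mu B < eps &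
          exists F : set G, finite_set F /\ set_prod F B = setT]
}.

Lemma inv_card_infinite (R : realType) (G : groupType) :
  infinite_set [set: G] -> inv_card R G = 0.
Proof.
move=> Ginf; rewrite /inv_card /fset_set; case: pselect => [/Ginf//|_].
by rewrite cardfs0 invr0.
Qed.

(* Main.v *)
Require Import Defs.
From mathcomp Require Import all_boot all_order all_algebra.
From mathcomp Require Import zify lra.

Set Implicit Arguments.
Unset Strict Implicit.
Unset Printing Implicit Defensive.

Import Order.TTheory GRing.Theory Num.Theory.

(* Boxes F_0 = {1}, F_(n+1) = F_n U F_n h_n (disjoint union) have 2^n
   elements, and n |-> sup_x |A /\ F_n x| / 2^n is nonincreasing, so its limit
   d is a submeasure; mu A = sup_g d (g A) is left-invariant. If mu A < 1,
   then the complement of A meets every F_n x for some n, hence contains L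
   points of every F_N x for some N. Pick one of them in each member of a
   maximal family of disjoint translates F_N z: the resulting set B is
   syndetic. It satisfies mu B <= 2^-k as soon as, for the j-th element g_j of
   G, every edge g_j F_(k+j+1) x contains at most 2^(j+1) points of B. For
   large L such a choice exists on finitely many translates, by a counting
   argument of Rosenfeld type (each further translate multiplies the number of
   admissible choices by at least L/2), and then on all of them by
   compactness. *)

(** * Counting argument for choices with a bounded load on every edge *)

Lemma card_bigcup_leq (S : Type) (T : finType) (r : seq S) (P : pred S)
    (F : S -> {set T}) :
  #|\bigcup_(i <- r | P i) F i| <= \sum_(i <- r | P i) #|F i|.
Proof.
elim/big_rec2: _ => [|i n A _ le_An]; first by rewrite cards0.
by rewrite (leq_trans (leq_card_setU _ _)) // leq_add2l.
Qed.

(* [E u] lists the pairs (edge through [u], capacity of that edge). *)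
Section Selection.
Variables (I C : finType) (T : eqType) (c : I -> C -> T).
Variables (E : T -> seq (seq T * nat)) (beta : nat) (a0 : C).
Hypothesis c_inj : forall i j a b, c i a = c j b -> i = j /\ a = b.
Hypothesis E_closed :
  forall u v e, e \in E u -> v \in e.1 -> e \in E v.
Hypothesis beta_gt0 : (0 < beta)%N.
Hypothesis cardC : (2 * beta <= #|C|)%N.
Hypothesis E_weight : forall u,
  (\sum_(e <- E u) (2 ^ size e.1)%:R / (beta ^ e.2)%:R <= 2^-1 :> rat)%R.

Implicit Types (D : {set I}) (f : {ffun I -> C}) (e : seq T * nat).

Let hit D f e := [set i in D | c i (f i) \in e.1].

Let valid D f :=
  [forall i in D, all (fun e => #|hit D f e| <= e.2) (E (c i (f i)))].

(** Partial choices are encoded as total functions frozen at [a0] off [D], so that each choice on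
    [D] is counted exactly once. *)
Let partial D :=
  [set f : {ffun I -> C} |
    [forall i, (i \notin D) ==> (f i == a0)] && valid D f].

Let restr D f : {ffun I -> C} := [ffun i => if i \in D then f i else a0].

Let validP D f :
  reflect (forall i e, i \in D -> e \in E (c i (f i)) -> #|hit D f e| <= e.2)
          (valid D f).
Proof.
apply: (iffP forall_inP) => [h i e iD ei|h i iD].
  by have /allP := h i iD; apply.
by apply/allP => e ei; apply: h ei.
Qed.

Let partialP D f :
  reflect ((forall i, i \notin D -> f i = a0) /\ valid D f) (f \in partial D).
Proof.
rewrite inE; apply: (iffP andP) => -[h v]; split=> //.
  by move=> i iD; apply/eqP; move/forallP/(_ i)/implyP : h; apply.
by apply/forallP => i; apply/implyP => iD; apply/eqP/h.
Qed.

Let validS D' D f f' : D' \subset D -> {in D', f' =1 f} ->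
  valid D f -> valid D' f'.
Proof.
move=> sD ff' /validP v; apply/validP => i e iD; rewrite ff' // => ei.
apply: leq_trans (v i e (subsetP sD _ iD) ei).
apply/subset_leq_card/subsetP => j; rewrite !inE => /andP[jD].
by rewrite ff' // (subsetP sD).
Qed.

Let restr_partial D' D f : D' \subset D -> valid D f ->
  restr D' f \in partial D'.
Proof.
move=> sD v; apply/partialP; split=> [i /negPf iD|]; first by rewrite ffunE iD.
by apply: validS v => // i iD; rewrite ffunE iD.
Qed.

(** The inductive claim of Rosenfeld's method: a new index has at least [2 * beta] values, and the
    factor 2 pays for the extensions that overload an edge. *)
Let grows D :=
  forall z, z \notin D -> beta * #|partial D| <= #|partial (z |: D)|.

(** The indices of [D :\: D'] are added one at a time. Read backwards, forgetting [r] indices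
    divides the number of admissible choices by at least [beta ^ r]. *)
Let grows_many m D D' : (forall D, #|D| < m -> grows D) ->
  #|D| <= m -> D' \subset D ->
  beta ^ #|D :\: D'| * #|partial D'| <= #|partial D|.
Proof.
move=> IH Dm; move En : #|D :\: D'| => n.
elim: n D' En => [|n IHn] D' En sD.
  move/eqP: En; rewrite cards_eq0 setD_eq0 => sD'.
  by rewrite mul1n (_ : D' = D) //; apply/eqP; rewrite eqEsubset sD.
have [z zD] : exists z, z \in D :\: D' by apply/set0Pn; rewrite -cards_eq0 En.
have [zD' zDD] : z \notin D' /\ z \in D by move: zD; rewrite inE => /andP.
have sz : z |: D' \subset D by rewrite subUset sub1set zDD.
apply: leq_trans (IHn (z |: D') _ sz); last first.
  by move: En; rewrite (cardsD1 z) zD setDDl setUC => -[].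
rewrite expnSr -mulnA leq_mul2l IH ?orbT //.
by apply: leq_trans Dm; apply: proper_card; apply/properP; split=> //; exists z.
Qed.

(** Validity ignores [z], so the value there is free; extensions that overload an edge through the
    new point are collected in [bad]. *)
Let ext D z :=
  [set f : {ffun I -> C} |
    [forall i, (i \notin z |: D) ==> (f i == a0)] && (valid D f)].

Let bad D z a e :=
  [set f in ext D z | (f z == a) && (e.2 < #|hit (z |: D) f e|)].

(* A bad extension is determined by the subset of the edge which it hits and by
   its restriction to the indices that miss the edge; at least [e.2] indices of
   [D] are thereby forgotten. *)
Let card_bad D z a e : z \notin D -> (forall D', #|D'| < #|D| -> grows D') ->
  #|bad D z a e| * beta ^ e.2 <= 2 ^ size e.1 * #|partial D|.
Proof.
move=> zD IH.
pose pat f := map_tuple (fun v => [exists i in z |: D, c i (f i) == v])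
  (in_tuple e.1).
rewrite -sum1_card (partition_big pat xpredT) //= big_distrl /=.
rewrite -card_bool -card_tuple -sum_nat_const.
apply: leq_sum => W _; rewrite sum1dep_card.
set fib := [set f | _].
have [->|[f0]] := set_0Vmem fib; first by rewrite cards0.
rewrite inE => /andP[f0b /eqP f0W].
pose J := hit (z |: D) f0 e.
(* By [c_inj] a point of the edge determines both the index and the value producing it, so the
   pattern of hit points fixes [f] on [J]. *)
have agree f i : f \in fib -> i \in J -> f i = f0 i.
  rewrite inE => /andP[_ /eqP fW]; rewrite inE => /andP[iD iJ].
  have : pat f0 = pat f by rewrite f0W fW.
  move/(congr1 val)/eq_in_map/(_ _ iJ) => H.
  have /existsP[j /andP[_ /eqP/c_inj[-> ->]]] //:
      [exists j in z |: D, c j (f j) == c i (f0 i)].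
  by rewrite -H; apply/existsP; exists i; rewrite iD eqxx.
have fibE f : f \in fib -> [/\ forall i, i \notin z |: D -> f i = a0,
    valid D f & f z = a].
  rewrite !inE => /andP[/andP[/andP[/forallP fo fv] /andP[/eqP fz _]] _].
  by split=> // i iD; apply/eqP; move/implyP: (fo i); apply.
have rinj : {in fib &, injective (restr (D :\: J))}.
  move=> f f' ff ff' e'; apply/ffunP => i.
  have [iJ|iJ] := boolP (i \in J); first by rewrite !agree.
  have [fo _ fz] := fibE f ff; have [fo' _ fz'] := fibE f' ff'.
  have [->|iz] := eqVneq i z; first by rewrite fz fz'.
  have [iD|iD] := boolP (i \in D).
    by move/ffunP/(_ i): e'; rewrite !ffunE inE iJ iD.
  by rewrite fo ?fo' // !inE negb_or iz.
rewrite -(card_in_imset rinj) mulnC.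
apply: leq_trans (grows_many IH (leqnn _) (subsetDl D J)).
apply: leq_mul.
  (* [J] has more than [e.2] elements, and at most one of them, namely [z], lies outside [D]. *)
  rewrite leq_pexp2l // setDDr setDv set0U.
  move: f0b; rewrite inE => /and3P[_ _]; rewrite -/J => Jt.
  rewrite -ltnS (leq_trans Jt) // (cardsD1 z J) -[X in _ <= X]add1n leq_add //.
    by case: (z \in J).
  apply/subset_leq_card/subsetP => i.
  by rewrite !inE => /andP[/negPf ->] /= /andP[->].
apply/subset_leq_card/subsetP => g /imsetP[f ff ->].
have [_ fv _] := fibE f ff.
by apply: restr_partial fv; exact: subsetDl.
Qed.

Let card_ext D z : z \notin D -> #|C| * #|partial D| <= #|ext D z|.
Proof.
move=> zD.
rewrite -cardsT -cardsX.
pose F (p : C * {ffun I -> C}) : {ffun I -> C} :=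
  [ffun i => if i == z then p.1 else p.2 i].
have Finj : {in setX [set: C] (partial D) &, injective F}.
  move=> [a f] [b g]; rewrite !inE /= => /andP[/forallP fo _].
  move=> /andP[/forallP go _] /ffunP FE.
  have := FE z; rewrite !ffunE eqxx /= => ->; congr pair.
  apply/ffunP => i; have := FE i; rewrite !ffunE /=.
  case: eqP => // -> _.
  by rewrite (eqP (implyP (fo z) zD)) (eqP (implyP (go z) zD)).
rewrite -(card_in_imset Finj).
apply/subset_leq_card/subsetP => g /imsetP[[a f]].
rewrite in_setX in_setT /= => /partialP[fo fv] ->; rewrite inE.
apply/andP; split.
  apply/forallP => i; apply/implyP; rewrite !inE negb_or ffunE.
  move=> /andP[/negPf ->].
  by move=> /fo /= ->.
apply: validS fv => // i iD; rewrite ffunE /=.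
by case: eqP => // iz; move: zD; rewrite -iz iD.
Qed.

(** An overloaded edge must pass through the new point: otherwise its load already comes from [D],
    where [f] is valid. [E_closed] then lists it among the edges of that point. *)
Let ext_bad D z f : f \in ext D z -> f \notin partial (z |: D) ->
  exists2 e, e \in E (c z (f z)) & f \in bad D z (f z) e.
Proof.
move=> fe; rewrite inE.
have := fe; rewrite inE => /andP[-> fv] /= /forall_inPn[i izD /allPn[e ei]].
rewrite -ltnNge => eh.
have bE e' : e' = e -> f \in bad D z (f z) e' by move=> ->; rewrite inE fe eqxx.
have [iz|iz] := eqVneq i z; first by exists e; rewrite ?bE // -iz.
have iD : i \in D by move: izD; rewrite !inE (negPf iz).
have [ze|ze] := boolP (c z (f z) \in e.1).
  by exists e; rewrite ?bE //; apply: E_closed ei ze.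
have /validP/(_ i e iD ei) := fv; rewrite leqNgt => /negP[].
apply: leq_trans eh _; apply/subset_leq_card/subsetP => j.
rewrite !inE => /andP[/orP[/eqP ->|->]] //.
by rewrite (negPf ze).
Qed.

(** Strong induction on the size of [D]. There are at least [#|C| * #|partial D|] extensions, the
    bad ones number at most half of this bound, and [cardC] concludes. *)
Let grows_all D : grows D.
Proof.
have [n] := ubnP #|D|; elim: n D => // n IHn D Dn z zD.
have IH D' : #|D'| < #|D| -> grows D'.
  by move=> h; apply: IHn; apply: leq_trans h _.
have cover : ext D z \subset partial (z |: D) :|:
    \bigcup_a \bigcup_(e <- E (c z a)) bad D z a e.
  apply/subsetP => f fe; rewrite inE; have [//|fp/=] := boolP (f \in partial _).
  have [e ee fb] := ext_bad fe fp.
  apply/bigcupP; exists (f z) => //.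
  by rewrite (big_rem _ ee) /= inE fb.
have := leq_trans (subset_leq_card cover) (leq_card_setU _ _).
move=> /(leq_trans (card_ext zD)).
set N := #|partial D|; set P := #|partial (z |: D)|.
set B := #|_| => le1.
(* Union bound: for each value [a], [card_bad] and [E_weight] leave at most [N / 2] bad
   extensions. *)
have le2 : (B%:R <= #|C|%:R * (N%:R / 2) :> rat)%R.
  apply: (@le_trans _ _ (\sum_(a : C) N%:R / 2)%R); last first.
    by rewrite sumr_const -[leLHS]mulr_natl.
  apply: (@le_trans _ _ (\sum_(a : C)
    \sum_(e <- E (c z a)) #|bad D z a e|%:R)%R).
    have leB : B <= \sum_(a : C) \sum_(e <- E (c z a)) #|bad D z a e|.
      apply: leq_trans (card_bigcup_leq _ _ _) _.
      by apply: leq_sum => a _; exact: card_bigcup_leq.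
    move: leB; rewrite -(ler_nat rat) natr_sum => /le_trans; apply.
    by under eq_bigr do rewrite natr_sum.
  apply: ler_sum => a _.
  apply: (@le_trans _ _ (N%:R *
    \sum_(e <- E (c z a)) (2 ^ size e.1)%:R / (beta ^ e.2)%:R)%R); last first.
    by rewrite ler_wpM2l // E_weight.
  rewrite big_distrr /=; apply: ler_sum => e _.
  rewrite mulrA ler_pdivlMr ?ltr0n ?expn_gt0 ?beta_gt0 //.
  by rewrite -!natrM ler_nat [leqRHS]mulnC card_bad.
have le3 : (#|C|%:R * N%:R <= P%:R + B%:R :> rat)%R.
  by rewrite -natrM -natrD ler_nat.
have le4 : ((2 * beta)%:R * N%:R <= #|C|%:R * N%:R :> rat)%R.
  by rewrite -!natrM ler_nat leq_mul2r cardC orbT.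
rewrite -(ler_nat rat) natrM; move: le2 le3 le4; rewrite natrM; lra.
Qed.

(** The empty choice is admissible, and growth up to the whole of [I] keeps the count positive. *)
Lemma exists_selection : exists f : I -> C, forall i e, e \in E (c i (f i)) ->
  #|[set j | c j (f j) \in e.1]| <= e.2.
Proof.
have : 0 < #|partial [set: I]|.
  have h : forall D, #|D| < #|I| -> grows D by move=> D _; exact: grows_all.
  have := grows_many h (max_card _) (sub0set [set: I]).
  apply: leq_trans; rewrite muln_gt0 expn_gt0 beta_gt0 /= card_gt0.
  apply/set0Pn; exists [ffun=> a0]; apply/partialP.
  split=> [i|]; first by rewrite ffunE.
  by apply/validP => i e; rewrite inE.
rewrite card_gt0 => /set0Pn[f /partialP[_ /validP fv]].
exists f => i e ei; have := fv i e (in_setT _) ei.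
by congr (_ <= _); apply: eq_card => j; rewrite !inE.
Qed.

End Selection.

From mathcomp Require Import all_classical all_reals.

Local Open Scope classical_set_scope.

(** * Compactness, to pass from finitely many translates to all of them *)

(** A form of König's lemma: the values at [e 0], [e 1], ... are fixed one by one in the finite set
    [C], keeping every constraint [P s] satisfiable. *)
Lemma compact_selection (T : eqType) (C : finType) (c0 : C) (e : nat -> T)
    (p : T -> nat) (P : seq T -> (T -> C) -> Prop) :
  cancel p e ->
  (forall s f f', {in s, f =1 f'} -> P s f -> P s f') ->
  (forall s s' f, {subset s <= s'} -> P s' f -> P s f) ->
  (forall s, exists f, P s f) -> exists f, forall s, P s f.
Proof.
move=> pK Plocal Pmono Pex.
pose good w := forall s, exists2 f, P s f &
  forall i, i < size w -> f (e i) = nth c0 w i.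
have good_next w : exists a, good w -> good (rcons w a).
  have [gw|] := pselect (good w); last by exists c0.
  apply: contrapT => /forallNP nogood.
  have /choice[sa saP] : forall a, exists s, forall f, P s f ->
      ~ forall i, i < size (rcons w a) -> f (e i) = nth c0 (rcons w a) i.
    move=> a; have /not_implyP[_ /existsNP[s h]] := nogood a.
    by exists s => f Pf fw; apply: h; exists f.
  (* If each letter [a] is excluded by a list [sa a], an [f] satisfying the constraint of all these
     lists together contradicts the exclusion of the letter it takes at [e (size w)]. *)
  have [f Pf fw] := gw (e (size w) :: flatten [seq sa a | a <- enum C]).
  apply: (saP (f (e (size w))) f).
    apply: Pmono Pf => x xs; rewrite inE; apply/orP; right.
    by apply/flattenP; exists (sa (f (e (size w)))) => //; apply: map_f;
      rewrite mem_enum.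
  move=> i; rewrite size_rcons ltnS nth_rcons leq_eqVlt => /predU1P[->|iw].
    by rewrite ltnn eqxx.
  by rewrite iw fw.
have [next nextP] := choice good_next.
pose w := fix w n := if n is m.+1 then rcons (w m) (next (w m)) else [::].
have goodw n : good (w n).
  elim: n => [|n IHn]; last exact: nextP.
  by move=> s; have [f Pf] := Pex s; exists f.
have sw n : size (w n) = n by elim: n => //= n IHn; rewrite size_rcons IHn.
have nthw m i : i < m -> nth c0 (w m) i = next (w i).
  elim: m => // m IHm; rewrite ltnS leq_eqVlt /= nth_rcons sw.
  move=> /predU1P[->|im].
    by rewrite ltnn eqxx.
  by rewrite im IHm.
exists (fun x => next (w (p x))) => s.
(* This prefix is long enough to determine all the values on [s], so [Plocal] transfers the
   constraint to the limit. *)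
have [f Pf fw] := goodw (\max_(x <- s) p x).+1 s.
apply: Plocal Pf => x xs.
have xm : p x < (\max_(x <- s) p x).+1 by rewrite ltnS; apply: leq_bigmax_seq.
by rewrite -[in LHS](pK x) fw ?sw // nthw.
Qed.

(** * Boxes and sparse syndetic sets *)

(** With [beta = 2 ^ (3 * 2 ^ k)], this says that the [2 ^ (k + j.+1)] edges of type [j] through a
    point weigh at most [2^-(j+2)] together. The 3 appears because each of the three exponents on
    the left is at most [2 ^ (k + j.+1)]. *)
Lemma edge_weight k j :
  2 ^ (k + j.+1) * 2 ^ (2 ^ (k + j.+1)) * 2 ^ j.+2
    <= (2 ^ (3 * 2 ^ k)) ^ (2 ^ j.+1).
Proof.
rewrite -expnM -[3 * _ * _]mulnA -!expnD leq_exp2l //.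
have lt1 : k + j.+1 < 2 ^ (k + j.+1) by exact: ltn_expl.
lia.
Qed.

Section Boxes.
Variables (G : groupType) (out : seq G -> G).
Hypothesis outP : forall s, out s \notin s.

(** [out] avoids all quotients of two elements of [box m], which makes the translated copy disjoint
    from [box m]. *)
Fixpoint box n : seq G :=
  if n is m.+1 then
    box m ++
    [seq (b * out [seq b1^-1 * b2 | b1 <- box m, b2 <- box m])%g | b <- box m]
  else [:: 1%g].

Lemma size_box n : size (box n) = 2 ^ n.
Proof.
by elim: n => //= n IHn; rewrite size_cat size_map IHn expnS mul2n addnn.
Qed.

Lemma box_uniq n : uniq (box n).
Proof.
elim: n => //= n IHn; rewrite cat_uniq IHn map_inj_uniq ?IHn ?andbT;
  last exact: mulIg.
apply/hasPn => _ /mapP[b bn ->]; apply/negP => bh.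
set s := [seq _ | _ <- _, _ <- _] in bh; have /negP[] := outP s.
by apply/allpairsP; exists (b, (b * out s)%g); rewrite mulKg.
Qed.

Definition hits n (A : set G) (x : G) :=
  count (fun b => `[< A (b * x)%g >]) (box n).

(** The new half of the box is a right translate of the old one, hence acts at [x] as the old one at
    [h * x]; the same [h] serves all [x]. *)
Lemma hitsS n A :
  exists h, forall x, hits n.+1 A x = hits n A x + hits n A (h * x)%g.
Proof.
eexists => x; rewrite /hits /= count_cat count_map; congr addn.
by apply: eq_count => b /=; rewrite mulgA.
Qed.

Lemma hits_grow n m A : (forall x, 0 < hits n A x) ->
  forall x, 2 ^ m <= hits (n + m) A x.
Proof.
move=> A_hit; elim: m => [|m IHm] x; first by rewrite addn0.
rewrite addnS; have [h ->] := hitsS (n + m) A.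
by rewrite expnS mul2n -addnn leq_add.
Qed.

Variables (e : nat -> G) (k : nat).

(** The left factor [e j] anticipates the supremum over left translates. A load of [2 ^ j.+1] on
    these [2 ^ (k + j.+1)] points is a proportion [2^-k]. *)
Definition edge j x := [seq (e j * (b * x))%g | b <- box (k + j.+1)].

Lemma edge_uniq j x : uniq (edge j x).
Proof. by rewrite map_inj_uniq ?box_uniq // => b b' /mulgI /mulIg. Qed.

(** An instance of [exists_selection] indexed by the elements of [s] in [Z], with
    [beta = 2 ^ (3 * 2 ^ k)]. *)
Lemma finite_sparse_selection (C : finType) (a0 : C) (c : G -> C -> G)
    (Z : set G) (s : seq G) :
  (forall z z' a a', Z z -> Z z' -> c z a = c z' a' -> z = z' /\ a = a') ->
  2 * 2 ^ (3 * 2 ^ k) <= #|C| ->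
  exists f : G -> C, forall j x,
    count (fun z => `[< Z z >] && (c z (f z) \in edge j x)) (undup s)
      <= 2 ^ j.+1.
Proof.
move=> c_inj cardC.
pose s1 := [seq z <- undup s | `[< Z z >]].
have s1u : uniq s1 by rewrite filter_uniq ?undup_uniq.
have s1Z (i : seq_sub s1) : Z (ssval i).
  by have := ssvalP i; rewrite mem_filter => /andP[/asboolP].
(* If [u] is the point of index [b] of [edge j x], then [x] is recovered as [b^-1 * ((e j)^-1 * u)].
   Only [j] below [size s1] is listed, to keep [E u] finite. *)
pose E u := [seq (edge j (b^-1 * ((e j)^-1 * u))%g, 2 ^ j.+1)
  | j <- iota 0 (size s1), b <- box (k + j.+1)].
have mem_E j x b : j < size s1 -> b \in box (k + j.+1) ->
    (edge j x, 2 ^ j.+1) \in E (e j * (b * x))%g.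
  move=> js bb; apply/allpairsPdep; exists j, b.
  by rewrite mem_iota add0n js bb !mulKg.
have E_closed u v d : d \in E u -> v \in d.1 -> d \in E v.
  move=> /allpairsPdep[j [b [+ _ ->]]] /mapP[b' bb' ->].
  by rewrite mem_iota add0n => js; exact: mem_E.
have E_weight u : (\sum_(d <- E u)
    (2 ^ size d.1)%:R / ((2 ^ (3 * 2 ^ k)) ^ d.2)%:R <= 2^-1 :> rat)%R.
  rewrite big_allpairs_dep /=.
  (* Type [j] contributes at most [2^-(j+2)], and these terms sum to less than 1/2. *)
  apply: (@le_trans _ _ (\sum_(j <- iota 0 (size s1)) 2^-1 ^+ j.+2)%R);
    last first.
    rewrite -{1}[size s1]subn0 -/(index_iota 0 (size s1)).
    suff -> : (\sum_(0 <= j < size s1) 2^-1 ^+ j.+2 =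
        2^-1 - 2^-1 ^+ (size s1).+1 :> rat)%R.
      by rewrite gerBl exprn_ge0.
    elim: (size s1) => [|m IHm]; first by rewrite big_nil subrr.
    rewrite big_nat_recr //= IHm -addrA; congr (_ + _)%R.
    by rewrite !exprS; lra.
  apply: ler_sum => j _.
  under eq_bigr do rewrite /= size_map size_box.
  rewrite -[X in (X <= _)%R]/(\sum_(b <- box (k + j.+1)) _)%R.
  rewrite big_const_seq count_predT size_box iter_addr_0 -[leLHS]mulr_natl.
  rewrite exprVn -[leRHS]mul1r mulrA ler_pdivlMr ?exprn_gt0 // mulrAC.
  rewrite ler_pdivrMr ?ltr0n ?expn_gt0 // mul1r -natrX -!natrM ler_nat.
  exact: edge_weight.
have [||f fP] := @exists_selection (seq_sub s1) C G (fun i => c (ssval i)) E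
    (2 ^ (3 * 2 ^ k)) a0 _ E_closed _ cardC E_weight.
- by move=> i j a b /c_inj[] // ij ->; split=> //; exact: val_inj.
- by rewrite expn_gt0.
exists (fun z => if insub z is Some i then f i else a0) => j x.
rewrite -size_filter; set t := [seq z <- undup s | _].
pose J := [set i : seq_sub s1 | c (ssval i) (f i) \in edge j x]%SET.
have tJ : {subset t <= [seq ssval i | i <- enum J]}.
  move=> z; rewrite mem_filter => /andP[/andP[Zz + zs]].
  have zs1 : z \in s1 by rewrite mem_filter Zz.
  case: insubP => [i _ <- ci|]; last by rewrite zs1.
  by apply/mapP; exists i; rewrite // mem_enum inE.
have tu : uniq t by rewrite filter_uniq ?undup_uniq.
have le_tJ : size t <= #|J|.
  by rewrite cardE -(size_map (@ssval _ s1)); exact: uniq_leq_size.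
(* For the unlisted [j] the capacity [2 ^ j.+1] exceeds the number of translates. *)
have [js|js] := ltnP j (size s1); last first.
  apply: leq_trans (_ : size s1 <= _).
    apply: uniq_leq_size tu _ => z; rewrite !mem_filter => /andP[/andP[-> _]].
    by [].
  by apply: leq_trans js (ltnW (ltnW _)); exact: ltn_expl.
apply: leq_trans le_tJ _.
have [->|[i iJ]] := finset.set_0Vmem J; first by rewrite cards0.
move: (iJ); rewrite inE => /mapP[b bb cE].
by apply: (fP i (edge j x, 2 ^ j.+1)); rewrite cE mem_E.
Qed.

(** Zorn's lemma: a translate of [s] disjoint from all the chosen ones could be added to the
    family. *)
Lemma maximal_disjoint_translates (s : seq G) : exists Z : set G,
  (forall z z' b b', Z z -> Z z' -> b \in s -> b' \in s ->
    (b * z = b' * z')%g -> z = z') /\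
  (forall x, s != [::] -> exists z b b',
    [/\ Z z, b \in s, b' \in s & (b * x = b' * z)%g]).
Proof.
pose P (Z : set G) := forall z z' b b', Z z -> Z z' -> b \in s -> b' \in s ->
  (b * z = b' * z')%g -> z = z'.
have [F FP Ftot|Z [PZ Zmax]] := @Zorn_bigcup G P.
  move=> z z' b b' [X FX Xz] [Y FY Yz'].
  have [XY|YX] := Ftot _ _ FX FY.
    by apply: FP FY _ _ _ _ (XY _ Xz) Yz'.
  by apply: FP FX _ _ _ _ Xz (YX _ Yz').
exists Z; split=> // x s0; apply: contrapT => nox.
have s_mem : exists b, b \in s.
  by case: (s) s0 => // b s' _; exists b; rewrite mem_head.
have [b bs] := s_mem.
have Zx : ~ Z x by move=> Zx; apply: nox; exists x, b, b.
apply: (Zmax (x |` Z)).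
  by split=> [z Zz|/(_ x)]; [right|move=> /(_ (or_introl erefl))].
move=> z z' b1 b2 [->|Zz] [->|Zz'] b1s b2s //.
- by move=> bz; case: nox; exists z', b1, b2.
- by move=> bz; case: nox; exists z, b2, b1.
- exact: PZ.
Qed.

Lemma sparse_syndetic (p : G -> nat) n (B0 : set G) : cancel p e ->
  (forall x, 0 < hits n B0 x) ->
  exists B : set G, [/\ B `<=` B0,
    exists F : set G, finite_set F /\ set_prod F B = setT &
    forall j x, count (fun b => `[< B (e j * (b * x))%g >]) (box (k + j.+1))
      <= 2 ^ j.+1].
Proof.
move=> pK /hits_grow hB0; pose L := 2 * 2 ^ (3 * 2 ^ k).
have LE : L = 2 ^ (3 * 2 ^ k).+1 by rewrite expnS.
(* By [hits_grow], enlarging the box from [n] to [N] guarantees [L] points of [B0] in every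
   translate. *)
pose N := n + (3 * 2 ^ k).+1.
have a0 : 'I_L by apply: (@Ordinal _ 0); rewrite LE expn_gt0.
pose cs z := [seq (b * z)%g | b <- box N & `[< B0 (b * z)%g >]].
(* The default [1] is never reached, since [cs z] has at least [L] entries. *)
pose c z (a : 'I_L) := nth 1%g (cs z) a.
have cs_size z : L <= size (cs z).
  by rewrite size_map size_filter LE; exact: hB0.
have cs_uniq z : uniq (cs z).
  by rewrite map_inj_uniq ?filter_uniq ?box_uniq //; exact: mulIg.
have cP z a : exists2 b, b \in box N & c z a = (b * z)%g /\ B0 (c z a).
  have : c z a \in cs z by rewrite mem_nth // (leq_trans (ltn_ord a)).
  move=> /mapP[b]; rewrite mem_filter => /andP[/asboolP Bb bN] ->.
  by exists b.
have [Z [Zdisj Zmax]] := maximal_disjoint_translates (box N).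
have c_inj z z' a a' : Z z -> Z z' -> c z a = c z' a' -> z = z' /\ a = a'.
  move=> Zz Zz' cE; have zz' : z = z'.
    have [b bN [cb _]] := cP z a; have [b' bN' [cb' _]] := cP z' a'.
    by apply: (Zdisj z z' b b') => //; rewrite -cb -cb'.
  split=> //; apply/val_inj/eqP; move: cE; rewrite -zz' => /eqP.
  by rewrite nth_uniq // (leq_trans (ltn_ord _)).
pose sparse (s : seq G) (f : G -> 'I_L) := forall j x,
  count (fun z => `[< Z z >] && (c z (f z) \in edge j x)) (undup s) <= 2 ^ j.+1.
have [|||f fP] := @compact_selection G 'I_L a0 e p sparse pK.
- move=> s f f' ff' sf j x.
  rewrite -(@eq_in_count _
    (fun z => `[< Z z >] && (c z (f z) \in edge j x))) //.
  by move=> z; rewrite mem_undup => zs; rewrite ff'.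
- move=> s s' f ss' sf j x; apply: leq_trans (sf j x); rewrite -!size_filter.
  apply: uniq_leq_size; first by rewrite filter_uniq ?undup_uniq.
  by move=> z; rewrite !mem_filter !mem_undup => /andP[-> /ss'].
- by move=> s; apply: finite_sparse_selection; rewrite ?card_ord.
exists [set c z (f z) | z in Z]; split.
- by move=> _ [z _ <-]; have [b _ []] := cP z (f z).
(* By maximality [b * x = b' * z] for some [z] in [Z], and the point picked for [z] is [d * z];
   hence [x] is [b^-1 * b' * d^-1] times that point. *)
- exists [set` [seq (u * d^-1)%g |
    u <- [seq (b^-1 * b')%g | b <- box N, b' <- box N], d <- box N]].
  split; first exact: finite_seq.
  apply/seteqP; split=> // x _.
  have [|z [b [b' [Zz bN bN' bE]]]] := Zmax x.
    by rewrite -size_eq0 size_box expn_eq0.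
  have [d dN [dE _]] := cP z (f z).
  exists (b^-1 * b' * d^-1)%g.
    by apply: allpairs_f => //; exact: allpairs_f.
  exists (c z (f z)); first by exists z.
  by rewrite dE mulgA mulgVK -mulgA -bE mulKg.
move=> j x; pose B := [set c z (f z) | z in Z].
have -> : count (fun b => `[< B (e j * (b * x))%g >]) (box (k + j.+1)) =
    size [seq v <- edge j x | `[< B v >]].
  by rewrite size_filter count_map.
set t := [seq v <- _ | _].
(* Sending each point of [B] on the edge to a translate it was picked for is injective, so the bound
   on the finite list [map h t] applies. *)
have /choice[h hP] v : exists z, v \in t -> Z z /\ c z (f z) = v.
  have [|vt] := boolP (v \in t); last by exists v.
  by rewrite mem_filter => /andP[/asboolP[z Zz zv] _]; exists z.
have ht_uniq : uniq (map h t).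
  rewrite map_inj_in_uniq ?filter_uniq ?edge_uniq // => v w vt wt hvw.
  by rewrite -(hP v vt).2 -(hP w wt).2 hvw.
apply: leq_trans (fP (map h t) j x).
rewrite undup_id // -(size_map h) -size_filter.
rewrite (_ : [seq _ <- _ | _] = map h t) //.
apply/all_filterP/allP => _ /mapP[v vt ->]; have [Zv ->] := hP v vt.
by rewrite asboolT //=; move: vt; rewrite mem_filter => /andP[].
Qed.

End Boxes.

Local Open Scope ring_scope.

(** * Upper density along the boxes and its left-invariant version *)

Section BoxDensity.
Variables (R : realType) (G : groupType) (out : seq G -> G).
Local Notation hits := (hits out).
Implicit Types (A B : set G) (x g : G) (r : R).

Definition ratio n A x : R := (hits n A x)%:R / 2 ^+ n.

Lemma ratio_ge0 n A x : 0 <= ratio n A x.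
Proof. by rewrite divr_ge0 ?exprn_ge0. Qed.

Lemma ratio_leE n A x m : (ratio n A x <= m%:R / 2 ^+ n) = (hits n A x <= m)%N.
Proof. by rewrite ler_pM2r ?invr_gt0 ?exprn_gt0 // ler_nat. Qed.

Lemma ratio_full n : (2 ^ n)%:R / 2 ^+ n = 1 :> R.
Proof. by rewrite natrX divff // expf_neq0 // pnatr_eq0. Qed.

Lemma ratio_le1 n A x : ratio n A x <= 1.
Proof.
rewrite -(ratio_full n) ratio_leE.
by rewrite -(size_box out) count_size.
Qed.

Definition box_density n A : R := sup (range (ratio n A)).

Lemma ratio_le_density n A x : ratio n A x <= box_density n A.
Proof.
apply: ub_le_sup; last by exists x.
by exists 1 => _ [y _ <-]; exact: ratio_le1.
Qed.

Lemma box_density_le n A r :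
  (forall x, ratio n A x <= r) -> box_density n A <= r.
Proof.
move=> le_r; apply: ge_sup => [|_ [x _ <-]//].
by exists (ratio n A 1%g); exists 1%g.
Qed.

Lemma box_density_ge0 n A : 0 <= box_density n A.
Proof. exact: le_trans (ratio_ge0 n A 1%g) (ratio_le_density _ _ _). Qed.

Lemma box_density_le1 n A : box_density n A <= 1.
Proof. by apply: box_density_le => x; exact: ratio_le1. Qed.

Lemma box_density_mono n A B : A `<=` B -> box_density n A <= box_density n B.
Proof.
move=> AB; apply: box_density_le => x.
apply: le_trans (ratio_le_density n B x); rewrite ratio_leE.
by apply: sub_count => b /asboolP Ab; apply/asboolP/AB.
Qed.

Lemma box_density_subadd n A B :
  box_density n (A `|` B) <= box_density n A + box_density n B.
Proof.
apply: box_density_le => x.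
apply: le_trans (lerD (ratio_le_density n A x) (ratio_le_density n B x)).
rewrite -mulrDl -natrD ratio_leE -count_predUI.
apply: leq_trans (leq_addr _ _); apply: sub_count => b /asboolP /= [h|h].
  by rewrite (asboolT h).
by rewrite (asboolT h) orbT.
Qed.

Lemma box_density0 n : box_density n set0 = 0.
Proof.
apply/le_anti; rewrite box_density_ge0 andbT; apply: box_density_le => x.
have := ratio_leE n set0 x 0; rewrite mul0r => ->.
by rewrite leqNgt -has_count; apply/hasPn => b _; apply/negP => /asboolP.
Qed.

Lemma box_densityT n : box_density n setT = 1.
Proof.
apply/le_anti; rewrite box_density_le1 /=.
apply: le_trans (ratio_le_density n setT 1%g).
rewrite -(ratio_full n) ler_pM2r ?invr_gt0 ?exprn_gt0 //.
rewrite ler_nat -(size_box out) -count_predT.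
by apply: sub_count => b _; exact/asboolP.
Qed.

(** By [hitsS], a ratio at level [n.+1] is the mean of two ratios at level [n]. *)
Lemma box_densityS n A : box_density n.+1 A <= box_density n A.
Proof.
apply: box_density_le => x; have [h hE] := hitsS out n A.
have := ratio_le_density n A x; have := ratio_le_density n A (h * x)%g.
rewrite /ratio hE natrD exprS invfM mulrCA mulrDl; lra.
Qed.

Lemma box_density_anti n m A : (n <= m)%N -> box_density m A <= box_density n A.
Proof.
move=> /subnKC <-; elim: (m - n)%N => [|d IHd]; first by rewrite addn0.
by rewrite addnS (le_trans (box_densityS _ _)).
Qed.

(** This infimum is a limit, by [box_densityS]. *)
Definition density A : R := inf (range (box_density ^~ A)).

Lemma density_le n A : density A <= box_density n A.
Proof.
apply: ge_inf; last by exists n.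
by exists 0 => _ [m _ <-]; exact: box_density_ge0.
Qed.

Lemma density_ge A r : (forall n, r <= box_density n A) -> r <= density A.
Proof.
move=> r_le; apply: lb_le_inf => [|_ [n _ <-]//].
by exists (box_density 0 A); exists 0%N.
Qed.

Lemma density_ge0 A : 0 <= density A.
Proof. by apply: density_ge => n; exact: box_density_ge0. Qed.

Lemma density_le1 A : density A <= 1.
Proof. exact: le_trans (density_le 0 A) (box_density_le1 0 A). Qed.

Lemma density_mono A B : A `<=` B -> density A <= density B.
Proof.
move=> AB; apply: density_ge => n.
exact: le_trans (density_le n A) (box_density_mono n AB).
Qed.

(** The two infima may be approached at different levels [n] and [m]; monotonicity brings both to
    the level [maxn n m]. *)
Lemma density_subadd A B : density (A `|` B) <= density A + density B.
Proof.
rewrite -lerBlDr; apply: density_ge => n; rewrite lerBlDl -lerBlDr.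
apply: density_ge => m; rewrite lerBlDl.
apply: le_trans (density_le (maxn n m) _) _.
apply: le_trans (box_density_subadd _ _ _) _.
by rewrite lerD ?box_density_anti ?leq_maxl ?leq_maxr.
Qed.

Lemma density0 : density set0 = 0.
Proof.
apply/le_anti; rewrite density_ge0 andbT.
by apply: le_trans (density_le 0 _) _; rewrite box_density0.
Qed.

Lemma densityT : density setT = 1.
Proof.
apply/le_anti; rewrite density_le1.
by apply: density_ge => n; rewrite box_densityT.
Qed.

Lemma translate_translate g h A :
  translate g (translate h A) = translate (g * h)%g A.
Proof.
rewrite /translate image_comp; congr (image A _).
by apply/funext => x /=; rewrite mulgA.
Qed.

Lemma translateE g A x : translate g A x = A (g^-1 * x)%g.
Proof.
apply/propext; split=> [[a Aa <-]|Ax]; first by rewrite mulKg.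
by exists (g^-1 * x)%g; rewrite // mulVKg.
Qed.

(** [density] is built from right translates of boxes, so left invariance is forced by a supremum
    over left translates; subadditivity survives it. *)
Definition invariant_density A : R :=
  sup (range (fun g => density (translate g A))).

Lemma density_le_invariant g A : density (translate g A) <= invariant_density A.
Proof.
apply: ub_le_sup; last by exists g.
by exists 1 => _ [h _ <-]; exact: density_le1.
Qed.

Lemma invariant_density_le A r :
  (forall g, density (translate g A) <= r) -> invariant_density A <= r.
Proof.
move=> le_r; apply: ge_sup => [|_ [g _ <-]//].
by exists (density (translate 1%g A)); exists 1%g.
Qed.

Lemma translate1 A : translate 1%g A = A.
Proof. by apply/funext => x; rewrite translateE invg1 mul1g. Qed.

Lemma density_le_invariant1 A : density A <= invariant_density A.
Proof. by rewrite -[X in density X]translate1 density_le_invariant. Qed.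

Lemma invariant_density_submeasure : is_submeasure invariant_density.
Proof.
have le1 A : invariant_density A <= 1.
  by apply: invariant_density_le => g; exact: density_le1.
split=> [A|A B AB|A B||].
- by rewrite le1 (le_trans (density_ge0 A)) // density_le_invariant1.
- apply: invariant_density_le => g; apply: le_trans (density_le_invariant g B).
  by apply: density_mono; exact: image_subset.
- apply: invariant_density_le => g; rewrite /translate image_setU.
  apply: le_trans (density_subadd _ _) _.
  by rewrite lerD ?density_le_invariant.
- apply/le_anti; rewrite -{2}density0 density_le_invariant1 andbT.
  by apply: invariant_density_le => g; rewrite /translate image_set0 density0.
- by apply/le_anti; rewrite le1 -{1}densityT density_le_invariant1.
Qed.

Lemma invariant_density_left_invariant : left_invariant invariant_density.
Proof.
move=> g A; apply/le_anti/andP; split; apply: invariant_density_le => h.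
  by rewrite translate_translate density_le_invariant.
have -> : translate h A = translate (h * g^-1)%g (translate g A).
  by rewrite translate_translate mulgVK.
exact: density_le_invariant.
Qed.

Hypothesis outP : forall s, out s \notin s.

Lemma invariant_density_syndetic (e : nat -> G) (p : G -> nat) A r :
  cancel p e -> 0 < r -> invariant_density A < 1 ->
  exists B : set G, [/\ B `<=` ~` A, invariant_density B < r &
    exists F : set G, finite_set F /\ set_prod F B = setT].
Proof.
move=> pK r_gt0 A_lt1.
have [n n_lt1] : exists n, box_density n A < 1.
  apply: contrapT => /forallNP nolt; move: A_lt1; apply/negP; rewrite -leNgt.
  apply: le_trans (density_le_invariant1 A).
  by apply: density_ge => n; have /negP := nolt n; rewrite -leNgt.
have CA_hit x : (0 < hits n (~` A) x)%N.
  have := le_lt_trans (ratio_le_density n A x) n_lt1.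
  rewrite ltNge; apply: contraNT; rewrite -eqn0Ngt => /eqP CA0.
  rewrite -(ratio_full n) ler_pM2r ?invr_gt0 ?exprn_gt0 //.
  rewrite ler_nat -(size_box out) -[leqRHS]addn0 -CA0.
  rewrite -(count_predC (fun b => `[< A (b * x)%g >])) leq_add2l.
  by apply: sub_count => b /= /asboolP nA; exact/asboolP.
have [k kr] : exists k, 2^-1 ^+ k < r.
  exists (Num.bound r^-1); rewrite exprVn -[ltRHS]invrK.
  rewrite ltf_pV2 ?posrE ?invr_gt0 //.
    apply: lt_le_trans (archi_boundP _) _; first by rewrite invr_ge0 ltW.
    by rewrite -natrX ler_nat ltnW // ltn_expl.
  by rewrite exprn_gt0.
have [B [BA synd sparse]] := sparse_syndetic outP k pK CA_hit.
exists B; split=> //; apply: le_lt_trans kr; apply: invariant_density_le => g.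
(* The index [j = p g^-1] has [e j = g^-1], so the points of a box translate lying in [g B]
   correspond to the points of [B] on an edge of type [j]. This level makes the ratio at most
   [2^-k]. *)
apply: le_trans (density_le (k + (p g^-1%g).+1) _) _.
apply: box_density_le => x.
rewrite (_ : 2^-1 ^+ k = (2 ^ (p g^-1%g).+1)%:R / 2 ^+ (k + (p g^-1%g).+1)).
  rewrite ratio_leE; apply: leq_trans (sparse (p g^-1%g) x).
  by apply: sub_count => b /=; rewrite translateE pK.
by rewrite exprD invfM mulrCA ratio_full mulr1 exprVn.
Qed.

End BoxDensity.

Theorem mainTheorem3 (R : realType) (G : groupType)
    (Gcount : countable [set: G]) (Ginf : infinite_set [set: G]) :
  exists mu : set G -> R, is_syndetic_submeasure mu.
Proof.
have /choice[out outP] (s : seq G) : exists x, x \notin s.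
  apply: contrapT => /forallNP s_all; apply: Ginf.
  apply: (sub_finite_set _ (finite_seq s)) => x _ /=.
  by have /negP := s_all x; rewrite negbK.
have /countable_injP[p p_inj] := Gcount.
(* A left inverse of [p], with the default [1] at numbers that [p] does not attain. *)
pose e m := xget 1%g [set x | p x = m].
have pe x : p (e (p x)) = p x.
  by apply: (@xgetPex _ 1%g [set y | p y = p x]); exists x.
have pK : cancel p e by move=> x; apply: p_inj; rewrite ?in_setT.
exists (invariant_density R out); split.
- exact: invariant_density_submeasure.
- exact: invariant_density_left_invariant.
move=> r A; rewrite inv_card_infinite // => r_gt0 A_lt1.
exact: (invariant_density_syndetic outP pK).
Qed.
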